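(* There exist two paths $\gamma,\tilde{\gamma}$ in $\mathbb{R}^2$ (continuous closed curves of finite $p$-variation for some $1\le p<2$) such that the winding numbers of $\gamma$ and $\tilde{\gamma}$ around every point are equal, but the fifth terms (the components in $(\mathbb{R}^2)^{\otimes5}$) of their signatures differ.
   Context: A continuous $\gamma:[0,1]\to\mathbb{R}^2$ has finite $p$-variation if $\sup\sum_k|\gamma_{t_{k+1}}-\gamma_{t_k}|^p<\infty$, the supremum being over all finite partitions; it is closed if $\gamma_0=\gamma_1$. For such $\gamma$ with $1\le p<2$, the signature is $S(\gamma)_{0,1}=1+\sum_{n\ge1}\int_{0<t_1<\cdots<t_n<1}\mathrm{d}\gamma_{t_1}\otimes\cdots\otimes\mathrm{d}\gamma_{t_n}$ (Young integrals), in the space of sequences $(a_0,a_1,\ldots)$, $a_i\in(\mathbb{R}^2)^{\otimes i}$. For a continuous closed curve $\gamma$ and $z\in\mathbb{R}^2\setminus\gamma[0,1]$, the winding number is $\eta(\gamma,z)=\frac1{2\pi}(\tilde g(1)-\tilde g(0))$, where $\tilde g:[0,1]\to\mathbb{R}$ is continuous with $e^{i\tilde g(s)}=(\gamma_s-z)/\|\gamma_s-z\|$ (identifying $\mathbb{R}^2$ with $\mathbb{C}$). ''Around every point'' means around every point not on the image of either curve. *)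

(* Defs.v *)
From HB Require Import structures.
From mathcomp Require Import all_boot all_order all_algebra.
From mathcomp Require Import all_classical all_reals all_analysis.

Set Implicit Arguments.
Unset Strict Implicit.
Unset Printing Implicit Defensive.

Import Order.TTheory GRing.Theory Num.Theory.
Import numFieldNormedType.Exports.

Local Open Scope classical_set_scope.
Local Open Scope ring_scope.

(* Planar curves are functions R -> 'rV[R]_2 of which only the restriction to
   `[0, 1] is ever used. *)

Section plane.
Context {R : realType}.

(* The library norm on matrices is the sup norm. *)
Definition euclid_norm (v : 'rV[R]_2) : R :=
  Num.sqrt (v 0 0 ^+ 2 + v 0 1 ^+ 2).

(* e^(i theta), with R^2 identified with C *)
Definition cis (theta : R) : 'rV[R]_2 :=
  \row_(j < 2) (if j == 0 then cos theta else sin theta).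

End plane.

Section p_variation.
Context {R : realType}.

(* Vector-valued counterpart of [variation], with the same encoding of
   partitions: the points are those of a :: s, the last one being b. *)
Definition p_variation_sum (p a b : R) (gamma : R -> 'rV[R]_2) (s : seq R) : R :=
  let x := nth b (a :: s) in
  \sum_(0 <= k < size s) euclid_norm (gamma (x k.+1) - gamma (x k)) `^ p.

Definition finite_p_variation (p a b : R) (gamma : R -> 'rV[R]_2) : Prop :=
  has_ubound [set p_variation_sum p a b gamma s | s in itv_partition a b].

End p_variation.

Section young_integral.
Context {R : realType}.

(* A tagged partition of [a, b] is a pair (s, xi): the points of the partition
   are those of a :: s and the k-th tag xi_k lies in [x_k, x_{k+1}]. *)
Definition tagged_partition (a b : R) (P : seq R * seq R) : Prop :=
  let x := nth b (a :: P.1) in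
  [/\ itv_partition a b P.1, size P.2 = size P.1 &
      forall k, (k < size P.1)%N -> x k <= nth b P.2 k <= x k.+1].

Definition mesh_lt (a b delta : R) (P : seq R * seq R) : Prop :=
  let x := nth b (a :: P.1) in
  forall k, (k < size P.1)%N -> x k.+1 - x k < delta.

Definition fine_partitions (a b : R) : set_system (seq R * seq R) :=
  filter_from [set delta : R | 0 < delta]
    (fun delta => tagged_partition a b `&` mesh_lt a b delta).

Definition stieltjes_sum (a b : R) (f g : R -> R) (P : seq R * seq R) : R :=
  let x := nth b (a :: P.1) in
  \sum_(0 <= k < size P.1) f (nth b P.2 k) * (g (x k.+1) - g (x k)).

(* int_a^b f dg for a <= b, as the limit of Riemann-Stieltjes sums when the mesh
   tends to 0; by Young's theorem it exists when f and g are continuous of finite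
   p- and q-variation with 1/p + 1/q > 1. *)
Definition young_integral (a b : R) (f g : R -> R) : R :=
  lim (stieltjes_sum a b f g @ fine_partitions a b).

End young_integral.

Section signature.
Context {R : realType}.

(* (R^2)^{\otimes n}, by coordinates in the basis e_{i_1} (x) ... (x) e_{i_n};
   the word i_1 ... i_n is the index. *)
Definition tensor (n : nat) := {ffun n.-tuple 'I_2 -> R}.

(* The word is read from the outermost integral: on [:: i_n; ...; i_1] the value
   at t is the integral of dgamma^{i_1}_{t_1} ... dgamma^{i_n}_{t_n} over
   0 < t_1 < ... < t_n < t. *)
Fixpoint iterated_integral (gamma : R -> 'rV[R]_2) (w : seq 'I_2) (t : R) : R :=
  if w is i :: w' then
    young_integral 0 t (iterated_integral gamma w') (fun u => gamma u 0 i)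
  else 1.

(* S(gamma)_{0,1}, as the sequence of its components *)
Definition signature (gamma : R -> 'rV[R]_2) (n : nat) : tensor n :=
  [ffun w : n.-tuple 'I_2 => iterated_integral gamma (rev w) 1].

End signature.

Section winding_number.
Context {R : realType}.

(* eta(gamma, z) = w. The lift g exists when gamma is continuous and avoids z, and
   it is unique up to an additive constant in 2 pi Z, so w is determined by gamma
   and z. *)
Definition is_winding_number (gamma : R -> 'rV[R]_2) (z : 'rV[R]_2) (w : R) :
    Prop :=
  exists g : R -> R,
    [/\ {within `[0, 1], continuous g},
        forall s, s \in `[0, 1] ->
          cis (g s) = (euclid_norm (gamma s - z))^-1 *: (gamma s - z) &
        w = (2 * pi)^-1 * (g 1 - g 0)].

End winding_number.

(* Main.v *)
(* The unit circle is taken once counterclockwise, starting at 1 for gamma and at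
   -1 for gamma'. The winding numbers agree: they are 1 inside and 0 outside. On
   the word 11112 the signature is the integral of (x - x_0)^4 / 24 dy, and the
   integrals for x_0 = a, with a = 1 or -1, have opposite nonzero values. For the
   winding numbers write z = - r e^(i alpha): an explicit lift of the argument of
   e^(i theta) - z is theta + arg (1 + r e^(i (alpha - theta))) if r < 1 and
   alpha + arg (r + e^(i (theta - alpha))) if r > 1, the arguments being arctangents
   since the real parts are positive. *)
Require Import Defs.
From HB Require Import structures.
From mathcomp Require Import all_boot all_order all_algebra.
From mathcomp Require Import all_classical all_reals all_analysis.
From mathcomp Require Import ring lra.
Import Order.TTheory GRing.Theory Num.Theory.
Import numFieldNormedType.Exports.
Local Open Scope classical_set_scope.
Local Open Scope ring_scope.

(** * Young integrals computed from antiderivatives *)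

Section young.
Set Implicit Arguments.
Unset Strict Implicit.
Context {R : realType}.
Implicit Types (a b : R) (f g F : R -> R).

Lemma itv_partition_nth_lt a b (s : seq R) k :
  itv_partition a b s -> (k < size s)%N ->
  nth b (a :: s) k < nth b (a :: s) k.+1.
Proof. by move=> [/(pathP b) + _] ks; apply. Qed.

Lemma itv_partition_telescope a b F s : itv_partition a b s ->
  \sum_(0 <= k < size s) (F (nth b (a :: s) k.+1) - F (nth b (a :: s) k)) =
  F b - F a.
Proof.
move=> abs; rewrite (telescope_sumr (fun k => F (nth b (a :: s) k)))//.
by rewrite (itv_partition_nth_size _ abs).
Qed.

(** Steps of length [delta / 2] are taken from the left until less than [delta] remains. This makes
    the filter of fine partitions proper, so that limits along it are unique. *)
Lemma fine_partition_exists a b (delta : R) : a <= b -> 0 < delta ->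
  exists P, tagged_partition a b P /\ mesh_lt a b delta P.
Proof.
move=> ab d0.
(* The induction is on a number [n] of half-steps that covers [b - a], with the left endpoint
   generalized. Taking [(s, s)] tags each cell by its right endpoint. *)
suff: forall n a, a <= b -> b - a <= n%:R * (delta / 2) ->
    exists s, itv_partition a b s /\ mesh_lt a b delta (s, s).
  have [n _ bn] : exists2 n, True & b - a <= n%:R * (delta / 2).
    exists (Num.truncn ((b - a) / (delta / 2))).+1 => //.
    by rewrite -ler_pdivrMr ?divr_gt0// ltW// truncnS_gt.
  move=> /(_ n a ab bn)[s [abs ms]]; exists (s, s); split=> //.
  split=> //= k ks; rewrite lexx andbT; exact: ltW (itv_partition_nth_lt abs ks).
have base a' : a' <= b -> b - a' < delta ->
    exists s, itv_partition a' b s /\ mesh_lt a' b delta (s, s).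
  rewrite le_eqVlt => /predU1P[<- _|a'b ba'].
    by exists [::]; split=> //; split.
  exists [:: b]; split; first exact: itv_partition1.
  by rewrite /mesh_lt /= => -[].
elim=> [|n ih] a' a'b.
  by rewrite mul0r => ba; apply: base => //; exact: le_lt_trans ba _.
move=> ba; have [|bad] := ltP (b - a') delta; first exact: base.
have [||s [[ps ls] ms]] := ih (a' + delta / 2); [lra| |].
  by move: ba; rewrite -natr1 mulrDl mul1r; lra.
exists (a' + delta / 2 :: s); split.
  by split=> //=; rewrite ps andbT; lra.
rewrite /mesh_lt /= => -[_ /=|k ks]; [lra|exact: ms].
Qed.

Global Instance fine_partitions_filter a b : Filter (fine_partitions a b).
Proof.
apply: filter_from_filter; first by exists 1 => /=.
move=> d1 d2 /= d10 d20; exists (Num.min d1 d2); first by rewrite /= lt_min d10.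
move=> P [tP mP]; split; split=> // x k kP; have := mP k kP;
  by rewrite lt_min => /andP[].
Qed.

Lemma fine_partitions_proper a b : a <= b -> ProperFilter (fine_partitions a b).
Proof.
move=> ab; apply: filter_from_proper => d d0.
exact: fine_partition_exists.
Qed.

(* On each cell the mean value theorem, applied to F - f xi * g with xi the tag,
   bounds the error by K * M * mesh * length. *)
Lemma young_integral_antiderivative a b f g g' F (K M : R) : a <= b ->
  {in `[a, b] &, forall x y, `|f x - f y| <= K * `|x - y|} ->
  (forall x, x \in `[a, b] -> is_derive x 1 g (g' x)) ->
  {in `[a, b], forall x, `|g' x| <= M} ->
  (forall x, x \in `[a, b] -> is_derive x 1 F (f x * g' x)) ->
  young_integral a b f g = F b - F a.
Proof.
move=> ab fK dg gM dF.
have PF := fine_partitions_proper ab.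
have aab : a \in `[a, b] by rewrite in_itv /= lexx.
have M0 : 0 <= M by apply: le_trans (gM _ aab).
(* For [a = b] the Lipschitz hypothesis does not exclude a negative [K]. *)
pose K' := Num.max K 0.
have K'0 : 0 <= K' by rewrite le_max lexx orbT.
have fK' : {in `[a, b] &, forall x y, `|f x - f y| <= K' * `|x - y|}.
  move=> x y xab yab; apply: le_trans (fK _ _ xab yab) _.
  by rewrite ler_wpM2r// le_max lexx.
have cell x y t : a <= x -> x <= t -> t <= y -> y <= b ->
    `|F y - F x - f t * (g y - g x)| <= K' * M * (y - x) * (y - x).
  move=> ax xt ty yb; have xy : x <= y by exact: le_trans ty.
  have sub z : z \in `[x, y] -> z \in `[a, b].
    by rewrite !in_itv/= => /andP[xz zy]; apply/andP; split;
      [exact: le_trans xz|exact: le_trans yb].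
  have dH z : z \in `[x, y] ->
      is_derive z 1 (F - f t \*: g) ((f z - f t) * g' z).
    move=> /sub zab; have dFz := dF _ zab; have dgz := dg _ zab.
    by apply: is_derive_eq; rewrite mulrBl.
  have [|c cxy] := MVT_segment xy (fun z zxy => dH z (subset_itv_oo_cc zxy)).
    by apply: derivable_within_continuous => z /dH [].
  rewrite !fctE /= => E.
  have -> : F y - F x - f t * (g y - g x) = (f c - f t) * g' c * (y - x).
    by rewrite -E /GRing.scale /=; ring.
  rewrite !normrM (ger0_norm (_ : 0 <= y - x)) ?subr_ge0//.
  apply: ler_wpM2r; first by rewrite subr_ge0.
  have txy : t \in `[x, y] by rewrite in_itv/= xt ty.
  have := fK' _ _ (sub _ cxy) (sub _ txy).
  move: (cxy); rewrite in_itv/= => /andP[xc cy] fct.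
  have -> : K' * M * (y - x) = (K' * (y - x)) * M by ring.
  apply: ler_pM => //; last by apply: gM; exact: sub.
  apply: le_trans fct _; rewrite ler_wpM2l// ler_norml; lra.
apply: cvg_lim => //; apply/cvgrPdist_le => e e0.
have KM0 : 0 <= K' * M by exact: mulr_ge0.
(* The total error will be at most [K' * M * d * (b - a)]; the [+ 1] keeps the denominator positive
   even if the product vanishes. *)
pose d := e / (K' * M * (b - a) + 1).
have D0 : 0 < K' * M * (b - a) + 1.
  by rewrite ltr_wpDl// mulr_ge0// subr_ge0.
have d0 : 0 < d by rewrite divr_gt0.
exists d => //= -[s xi] [[/= abs sz xiP] mP].
rewrite /stieltjes_sum /= -(itv_partition_telescope F abs) -sumrB.
apply: le_trans (ler_norm_sum _ _ _) _.
(* One factor of the squared cell length is bounded by the mesh; the other is kept and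
   telescopes. *)
apply: (@le_trans _ _ (\sum_(0 <= k < size s)
    (K' * M * d * nth b (a :: s) k.+1 - K' * M * d * nth b (a :: s) k))).
  rewrite !big_nat; apply: ler_sum => k /= ks.
  have /andP[x1 x2] := xiP _ ks.
  have ax := itv_partition_nth_ge (ltnW ks : (k < (size s).+1)%N) abs.
  have xb := itv_partition_nth_le (ks : (k.+1 < (size s).+1)%N) abs.
  apply: le_trans (cell _ _ _ ax x1 x2 xb) _.
  rewrite -mulrBr ler_wpM2r ?subr_ge0 ?(le_trans x1 x2)//.
  by rewrite ler_wpM2l// ltW// mP.
rewrite (itv_partition_telescope (fun x => K' * M * d * x) abs) -mulrBr.
rewrite /d mulrAC mulrA ler_pdivrMr// mulrC ler_pM2l//.
by rewrite lerDl.
Qed.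


(** * Lipschitz bounds and iterated integrals of a single coordinate *)

Lemma lipschitz_of_derive a b f f' (K : R) :
  (forall x, x \in `[a, b] -> is_derive x 1 f (f' x)) ->
  {in `[a, b], forall x, `|f' x| <= K} ->
  {in `[a, b] &, forall x y, `|f x - f y| <= K * `|x - y|}.
Proof.
move=> df fK.
suff wlog_le x y : x <= y -> x \in `[a, b] -> y \in `[a, b] ->
    `|f y - f x| <= K * `|y - x|.
  move=> x y xab yab; have [xy|/ltW yx] := leP x y; last exact: wlog_le.
  by rewrite distrC (distrC x); exact: wlog_le.
move=> xy xab yab.
have sub z : z \in `[x, y] -> z \in `[a, b].
  move: xab yab; rewrite !in_itv/= => /andP[ax _] /andP[_ yb] /andP[xz zy].
  by rewrite (le_trans ax xz) (le_trans zy yb).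
have dfxy z : z \in `[x, y] -> is_derive z 1 f (f' z) by move=> /sub; exact: df.
have [|z zxy ->] := MVT_segment xy (fun z zxy => dfxy z (subset_itv_oo_cc zxy)).
  by apply: derivable_within_continuous => z /dfxy [].
by rewrite normrM ler_wpM2r// fK// sub.
Qed.

(** These powers are the iterated integrals over a repeated letter, and the bound lets them serve as
    integrands in [young_integral_antiderivative]. On [[0, t]] the increment [f x - f 0] is at most
    [M * t] in absolute value, which bounds the derivative of its power. *)
Lemma lipschitz_power_of_derive f f' (M t : R) n : 0 <= t ->
  (forall x : R, is_derive x 1 f (f' x)) -> (forall x, `|f' x| <= M) ->
  exists K, {in `[0, t] &, forall x y,
    `|(f x - f 0) ^+ n / n`!%:R - (f y - f 0) ^+ n / n`!%:R| <= K * `|x - y|}.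
Proof.
move=> t0 df fM.
have f0 x : x \in `[0, t] -> `|f x - f 0| <= M * t.
  move=> xt; have := @lipschitz_of_derive 0 t f f' M (fun x _ => df x) (fun x _ => fM x).
  have z : 0 \in `[0, t] by rewrite in_itv/= lexx.
  move=> /(_ _ _ xt z) /le_trans; apply; rewrite subr0.
  have M0 : 0 <= M := le_trans (normr_ge0 _) (fM 0).
  move: xt; rewrite in_itv/= => /andP[x0 xt].
  by rewrite ler_wpM2l// ger0_norm.
(* The chain rule gives this constant; for [n = 0] the factor [n%:R] makes it 0. *)
exists (n`!%:R^-1 * (n%:R * (M * t) ^+ n.-1 * M)).
pose h' x : R := n`!%:R^-1 * ((n%:R * (f x - f 0) ^+ n.-1) * f' x).
have E x : (f x - f 0) ^+ n / n`!%:R = (n`!%:R^-1 \*: (f - cst (f 0)) ^+ n) x.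
  by rewrite mulrC exprfctE.
move=> x y xt yt; rewrite !E.
apply: (@lipschitz_of_derive 0 t _ h') => // z zt.
  by apply: is_derive_eq; rewrite subr0.
rewrite !normrM normfV !normr_nat normrX.
rewrite ler_wpM2l ?invr_ge0 ?ler0n// ler_pM ?mulr_ge0 ?exprn_ge0//.
by rewrite ler_wpM2l// lerXn2r ?nnegrE ?f0// (le_trans _ (f0 _ zt)).
Qed.

(* Holds for t >= 0 only: the derivative of the coordinate is taken on the whole
   line, but [young_integral 0 t] is junk for t < 0. *)
Lemma iterated_integral_nseq (gamma : R -> 'rV[R]_2) i f' (M : R) n (t : R) :
  (forall x : R, is_derive x 1 (fun u => gamma u 0 i) (f' x)) ->
  (forall x, `|f' x| <= M) -> 0 <= t ->
  iterated_integral gamma (nseq n i) t =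
  (gamma t 0 i - gamma 0 0 i) ^+ n / n`!%:R.
Proof.
move=> df fM; elim: n t => [|n ih] t t0; first by rewrite expr0 fact0 divr1.
have [K fK] := lipschitz_power_of_derive n t0 df fM.
have ihE x : x \in `[0, t] -> iterated_integral gamma (nseq n i) x =
    (gamma x 0 i - gamma 0 0 i) ^+ n / n`!%:R.
  by rewrite in_itv/= => /andP[x0 _]; exact: ih.
pose f : R -> R := fun u => gamma u 0 i.
(* An antiderivative of the inner iterated integral times [f'], normalized to vanish at 0. *)
pose F : R -> R := n.+1`!%:R^-1 \*: (f - cst (f 0)) ^+ n.+1.
transitivity (F t - F 0); last first.
  by rewrite /F !fctE /= subrr expr0n /= /GRing.scale /= mulr0 subr0 mulrC.
rewrite [LHS]/=.
apply: (young_integral_antiderivative (g' := f') (K := K) (M := M)) => //.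
- by move=> x y xt yt; rewrite !ihE//; exact: fK.
- move=> x xt; rewrite ihE//; apply: is_derive_eq.
  rewrite subr0 /GRing.scale /= factS natrM invfM.
  have n0 : n.+1%:R != 0 :> R by rewrite pnatr_eq0.
  have nf0 : n`!%:R != 0 :> R by rewrite pnatr_eq0 -lt0n fact_gt0.
  by rewrite !fctE; field; rewrite nf0 nat1r n0.
Qed.

End young.

(** * The unit circle and its signature on the word 11112 *)

Section circle.
Context {R : realType}.
Set Implicit Arguments.
Unset Strict Implicit.
Implicit Types (c t x a r : R) (z v : 'rV[R]_2).

(** The phase [c] is the angle of the starting point: 0 gives the start 1, and [pi] gives -1. *)
Definition circle c t : 'rV[R]_2 := cis (2 * pi * t + c).

Lemma circle0E c t : circle c t 0 0 = cos (2 * pi * t + c).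
Proof. by rewrite mxE. Qed.

Lemma circle1E c t : circle c t 0 1 = sin (2 * pi * t + c).
Proof. by rewrite mxE. Qed.

Let is_derive_phase c t : is_derive t 1 (fun u => 2 * pi * u + c) (2 * pi).
Proof.
have -> : (fun u => 2 * pi * u + c) = (2 * pi) \*: id + cst c by [].
by apply: is_derive_eq; rewrite addr0 /GRing.scale /= mulr1.
Qed.

Lemma is_derive_circle0 c t :
  is_derive t 1 (fun u => circle c u 0 0) (- sin (2 * pi * t + c) * (2 * pi)).
Proof.
rewrite (funext (circle0E c)).
exact: is_derive1_comp (is_derive_cos _) (is_derive_phase _ _).
Qed.

Lemma is_derive_circle1 c t :
  is_derive t 1 (fun u => circle c u 0 1) (cos (2 * pi * t + c) * (2 * pi)).
Proof.
rewrite (funext (circle1E c)).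
exact: is_derive1_comp (is_derive_sin _) (is_derive_phase _ _).
Qed.

Let pi2_ge0 : 0 <= 2 * pi :> R.
Proof. by rewrite mulr_ge0// pi_ge0. Qed.

Lemma circle_period c : circle c 1 = circle c 0.
Proof.
apply/rowP => j; rewrite !mxE mulr0 mulr1 add0r (addrC _ c) mulr_natl.
by rewrite cosD2pi sinD2pi.
Qed.

(** The classical reduction formula for the integral of a power of the cosine, obtained by
    integration by parts. *)
Fixpoint cos_pow_primitive n x : R :=
  match n with
  | 0 => x
  | 1 => sin x
  | (m.+1 as k).+1 =>
      (sin x * cos x ^+ k + k%:R * cos_pow_primitive m x) / n%:R
  end.

Lemma is_derive_cos_pow_primitive n x :
  is_derive x 1 (cos_pow_primitive n) (cos x ^+ n).
Proof.
(* The recursion goes down by two, so consecutive exponents are treated together. *)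
suff : is_derive x 1 (cos_pow_primitive n) (cos x ^+ n) /\
  is_derive x 1 (cos_pow_primitive n.+1) (cos x ^+ n.+1) by case.
elim: n => [|n [ih ih1]].
  by split; [exact: is_derive_id|exact: is_derive_sin].
split=> //.
have -> : cos_pow_primitive n.+2 = n.+2%:R^-1 \*:
    (sin * cos ^+ n.+1 + n.+1%:R \*: cos_pow_primitive n) :> (R -> R).
  by apply/funext => y; rewrite /= mulrC !fctE.
apply: is_derive_eq.
rewrite !fctE /GRing.scale /=.
have n0 : n.+2%:R != 0 :> R by rewrite pnatr_eq0.
apply: (mulfI n0); rewrite mulVKf//.
have s2 := sin2cos2 x.
transitivity (- sin x ^+ 2 * (n.+1%:R * cos x ^+ n) +
   cos x ^+ n.+2 + n.+1%:R * cos x ^+ n); first by rewrite !exprS; ring.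
by rewrite s2 -(natr1 n.+1) !exprS; ring.
Qed.

(** With [a = cos c], this is the integral of [(cos x - a) ^+ 4 * cos x / 24] over a full period.
    Odd powers of the cosine integrate to 0; the terms [- 4 * a * cos x ^+ 4] and
    [- 4 * a ^+ 3 * cos x ^+ 2] remain, with means [- 3 * a / 2] and [- 2 * a ^+ 3]. *)
Lemma iterated_integral_circle c :
  iterated_integral (circle c) [:: 1; 0; 0; 0; 0] 1 =
  - (3 * cos c + 4 * cos c ^+ 3) * pi / 24.
Proof.
pose a := cos c.
pose X t : R := circle c t 0 0.
pose X' t : R := - sin (2 * pi * t + c) * (2 * pi).
have X'M t : `|X' t| <= 2 * pi.
  by rewrite normrM normrN (ger0_norm pi2_ge0) ler_piMl// sin_max.
have [K fK] := lipschitz_power_of_derive 4 ler01 (is_derive_circle0 c) X'M.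
have inner t : t \in `[0, 1] ->
    iterated_integral (circle c) [:: 0; 0; 0; 0] t = (X t - a) ^+ 4 / 24.
  rewrite in_itv/= => /andP[t0 _].
  have /= -> := iterated_integral_nseq 4 (is_derive_circle0 c) X'M t0.
  by rewrite /X /a !circle0E mulr0 add0r.
(* The binomial expansion, integrated term by term. *)
pose H : R -> R := 24^-1 \*: (cos_pow_primitive 5 - (4 * a) \*: cos_pow_primitive 4
  + (6 * a ^+ 2) \*: cos_pow_primitive 3 - (4 * a ^+ 3) \*: cos_pow_primitive 2
  + (a ^+ 4) \*: cos_pow_primitive 1).
have dH x : is_derive x 1 H ((cos x - a) ^+ 4 / 24 * cos x).
  have dI := is_derive_cos_pow_primitive.
  by apply: is_derive_eq; rewrite /GRing.scale /=; field.
(* Between the two ends only the linear parts of the primitives change: [3 / 8 * x] for exponent 4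
   and [x / 2] for exponent 2. *)
transitivity (H (2 * pi * 1 + c) - H (2 * pi * 0 + c)); last first.
  rewrite mulr0 mulr1 add0r (addrC _ c) mulr_natl /H !fctE /= /GRing.scale /=.
  by rewrite cosD2pi sinD2pi -mulr_natr -/a; field.
apply: (young_integral_antiderivative
  (f := iterated_integral (circle c) [:: 0; 0; 0; 0]) (F := H \o (fun u => 2 * pi * u + c))
  (g' := fun t => cos (2 * pi * t + c) * (2 * pi)) (K := K) (M := 2 * pi)) => //.
- by move=> x y x1 y1; rewrite !inner//; have := fK _ _ x1 y1;
    rewrite (_ : 4`!%:R = 24 :> R)// -/(X x) -/(X y) -/(X 0) (_ : X 0 = a)//
    /X circle0E mulr0 add0r.
- by move=> x _; exact: is_derive_circle1.
- by move=> x _; rewrite normrM (ger0_norm pi2_ge0) ler_piMl// cos_max.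
- move=> x x1; rewrite inner// mulrA /X circle0E.
  exact: is_derive1_comp (dH _) (is_derive_phase _ _).
Qed.

(** * Polar coordinates and the winding numbers of the circle *)

Lemma cisE x : cis x = cos x *: delta_mx 0 0 + sin x *: delta_mx 0 1.
Proof.
by apply/rowP => -[[|[|//]] i2]; rewrite !mxE /= ?(mulr0, mulr1, addr0, add0r).
Qed.

Lemma continuous_phase c : continuous (fun t : R => 2 * pi * t + c).
Proof.
by move=> t; apply/differentiable_continuous/derivable1_diffP;
  case: (is_derive_phase c t).
Qed.

Lemma continuous_circle c : continuous (circle c).
Proof.
have -> : circle c = (fun t => cos (2 * pi * t + c) *: delta_mx 0 0 +
    sin (2 * pi * t + c) *: delta_mx 0 1).
  by apply/funext => t; rewrite /circle cisE.
have cc := @continuous_phase c.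
move=> t; apply: cvgD; apply: cvgZr_tmp.
  by apply: (continuous_comp (cc t)); exact: continuous_cos.
by apply: (continuous_comp (cc t)); exact: continuous_sin.
Qed.

Lemma euclid_norm_ge0 v : 0 <= euclid_norm v.
Proof. exact: sqrtr_ge0. Qed.

Lemma euclid_norm_le v : euclid_norm v <= `|v 0 0| + `|v 0 1|.
Proof.
rewrite -(ger0_norm (addr_ge0 (normr_ge0 _) (normr_ge0 _))) -sqrtr_sqr.
rewrite ler_sqrt ?sqr_ge0// sqrrD !real_normK ?num_real//.
by rewrite addrAC lerDl mulrn_wge0// mulr_ge0.
Qed.

Lemma sqr_euclid_norm v : euclid_norm v ^+ 2 = v 0 0 ^+ 2 + v 0 1 ^+ 2.
Proof. by rewrite sqr_sqrtr// addr_ge0// sqr_ge0. Qed.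

Lemma row2P (v w : 'rV[R]_2) : v 0 0 = w 0 0 -> v 0 1 = w 0 1 -> v = w.
Proof.
move=> vw0 vw1; apply/rowP => -[[|[|//]] i2].
  by rewrite (_ : Ordinal i2 = 0)//; exact/val_inj.
by rewrite (_ : Ordinal i2 = 1)//; exact/val_inj.
Qed.

(** The angle is the arccosine of the normalized first coordinate, or [2 * pi] minus it when the
    second coordinate is negative. Its range is later rescaled to the parameter interval
    [[0, 1]]. *)
Lemma polar_form v : exists2 x, 0 <= x <= 2 * pi & v = euclid_norm v *: cis x.
Proof.
have [v0|vn0] := eqVneq (euclid_norm v) 0.
  exists 0; first by rewrite lexx pi2_ge0.
  have /eqP := sqr_euclid_norm v; rewrite v0 scale0r expr0n /= eq_sym.
  rewrite paddr_eq0 ?sqr_ge0// !sqrf_eq0 => /andP[/eqP v00 /eqP v01].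
  by apply: row2P; rewrite mxE.
set r := euclid_norm v in vn0 *.
have r0 : 0 < r by rewrite lt_def vn0 euclid_norm_ge0.
have E : 1 - (v 0 0 / r) ^+ 2 = (v 0 1 / r) ^+ 2.
  apply/eqP; rewrite subr_eq !expr_div_n -mulrDl addrC -sqr_euclid_norm.
  by rewrite divff// sqrf_eq0.
have xB : -1 <= v 0 0 / r <= 1.
  by rewrite -ler_norml -(@expr_le1 _ 2)// real_normK ?num_real// -subr_ge0 E sqr_ge0.
have [v1|v1] := leP 0 (v 0 1).
  exists (acos (v 0 0 / r)).
    by rewrite acos_ge0// (le_trans (acos_lepi xB))// mulr_natl mulr2n lerDl pi_ge0.
  apply: row2P; rewrite !mxE /=; first by rewrite acosK// mulrC divfK.
  rewrite sin_acos// E sqrtr_sqr ger0_norm; last by rewrite divr_ge0// ltW.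
  by rewrite mulrC divfK.
exists (- acos (v 0 0 / r) + pi *+ 2).
  by have := acos_ge0 xB; have := acos_lepi xB; have := pi_ge0 R; lra.
apply: row2P; rewrite !mxE /= ?cosD2pi ?sinD2pi ?cosN ?sinN.
  by rewrite acosK// mulrC divfK.
rewrite sin_acos// E sqrtr_sqr ltr0_norm; last by rewrite pmulr_llt0// invr_gt0.
by rewrite opprK mulrC divfK.
Qed.

(** The hypotheses say that [v] is [p + i q] rotated by [alpha]; since [p > 0], the argument of
    [p + i q] is [atan (q / p)]. *)
Lemma cis_add_atan (alpha p q : R) v : 0 < p ->
  v 0 0 = p * cos alpha - q * sin alpha ->
  v 0 1 = p * sin alpha + q * cos alpha ->
  cis (alpha + atan (q / p)) = (euclid_norm v)^-1 *: v.
Proof.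
move=> p0 v0 v1.
have pn0 : p != 0 by rewrite gt_eqF.
have N2 : euclid_norm v ^+ 2 = p ^+ 2 * (1 + (q / p) ^+ 2).
  rewrite sqr_euclid_norm v0 v1.
  transitivity ((p ^+ 2 + q ^+ 2) * (cos alpha ^+ 2 + sin alpha ^+ 2)); first by ring.
  by rewrite cos2Dsin2; field.
have N : euclid_norm v = p * Num.sqrt (1 + (q / p) ^+ 2).
  rewrite -(ger0_norm (euclid_norm_ge0 v)) -sqrtr_sqr N2 sqrtrM ?sqr_ge0//.
  by rewrite sqrtr_sqr gtr0_norm.
have ca : cos (atan (q / p)) = (euclid_norm v)^-1 * p.
  by rewrite cos_atan N invfM mulrAC mulVf// mul1r.
have sa : sin (atan (q / p)) = (euclid_norm v)^-1 * q.
  have can0 : cos (atan (q / p)) != 0.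
    by rewrite cos_atan invr_eq0 sqrtr_eq0 -ltNge ltr_wpDr// sqr_ge0.
  rewrite -[LHS](divfK can0) -/(tan _) atanK ca; field.
  by rewrite pn0 -sqrf_eq0 N2 mulf_neq0 ?expf_neq0// gt_eqF// ltr_wpDr// sqr_ge0.
by apply: row2P; rewrite !mxE /= ?cosD ?sinD ca sa ?v0 ?v1; ring.
Qed.

Lemma is_winding_number_circle c r alpha : 0 <= r -> r != 1 ->
  is_winding_number (circle c) (- (r *: cis alpha)) (if r < 1 then 1 else 0).
Proof.
move=> r0 r1.
have cphase (s x : R) : {for s, continuous (fun t => 2 * pi * t + x)}.
  exact: continuous_phase.
have catan (p q : R -> R) : continuous p -> continuous q -> (forall s, 0 < p s) ->
    continuous (fun s => atan (q s / p s)).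
  move=> cp cq p0 s; apply: (@continuous_comp _ _ _ (fun s => q s / p s) atan).
    by apply: cvgM; [exact: cq|apply: cvgV; [rewrite gt_eqF|exact: cp]].
  exact: continuous_atan.
have ccos (x : R) : continuous (fun s => cos (2 * pi * s + x)).
  by move=> s; apply: continuous_comp; [exact: cphase|exact: continuous_cos].
have csin (x : R) : continuous (fun s => sin (2 * pi * s + x)).
  by move=> s; apply: continuous_comp; [exact: cphase|exact: continuous_sin].
have per (x : R) : (cos (2 * pi * 1 + x) = cos (2 * pi * 0 + x)) *
    (sin (2 * pi * 1 + x) = sin (2 * pi * 0 + x)).
  by rewrite mulr1 mulr0 add0r (addrC _ x) mulr_natl cosD2pi sinD2pi.
have pi2n0 : 2 * pi != 0 :> R by rewrite mulf_neq0// gt_eqF// pi_gt0.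
case: ltP => [rlt1|rge1].
(* Here [p + i q] is [1 + r e^(i (alpha - theta))], the quotient of [e^(i theta) - z] by
   [e^(i theta)]. *)
- pose p s : R := 1 + r * cos (2 * pi * s + (c - alpha)).
  pose q s : R := - r * sin (2 * pi * s + (c - alpha)).
  have p0 s : 0 < p s.
    have := cos_geN1 (2 * pi * s + (c - alpha)); rewrite /p; nra.
  have cp : continuous p.
    by move=> s; apply: cvgD; [exact: cvg_cst|apply: cvgMr; exact: ccos].
  have cq : continuous q by move=> s; apply: cvgMr; exact: csin.
  (* The linear term grows by [2 * pi] while the arctangent returns to its initial value. *)
  exists (fun s => (2 * pi * s + c) + atan (q s / p s)); split.
  + apply: continuous_subspaceT => s; apply: cvgD; first exact: cphase.
    exact: catan.
  + move=> s _; apply: cis_add_atan => //; rewrite !mxE /= /p /q opprK addrA;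
      set th := _ + c; rewrite cosB sinB;
      have := cos2Dsin2 th => E.
    (* Inserting [cos th ^+ 2 + sin th ^+ 2 = 1] turns the goal into a polynomial identity. *)
    * transitivity (cos th + r * (cos alpha * (cos th ^+ 2 + sin th ^+ 2))).
        by rewrite E mulr1.
      by ring.
    * transitivity (sin th + r * (sin alpha * (cos th ^+ 2 + sin th ^+ 2))).
        by rewrite E mulr1.
      by ring.
  + by rewrite /p /q !per mulr0 mulr1 !add0r -(addrA (2 * pi)) addrK mulVf.
(* Now the quotient is by [e^(i alpha)], which is constant, so the lift is periodic. *)
- pose p s : R := r + cos (2 * pi * s + (c - alpha)).
  pose q s : R := sin (2 * pi * s + (c - alpha)).
  have rgt1 : 1 < r by rewrite lt_def r1.
  have p0 s : 0 < p s.
    have := cos_geN1 (2 * pi * s + (c - alpha)); rewrite /p; lra.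
  have cp : continuous p by move=> s; apply: cvgD; [exact: cvg_cst|exact: ccos].
  exists (fun s => alpha + atan (q s / p s)); split.
  + apply: continuous_subspaceT => s; apply: cvgD; first exact: cvg_cst.
    by apply: catan => //; exact: csin.
  + move=> s _; apply: cis_add_atan => //; rewrite !mxE /= /p /q opprK addrA;
      set th := _ + c; rewrite cosB sinB;
      have := cos2Dsin2 alpha => E.
    * transitivity (cos th * (cos alpha ^+ 2 + sin alpha ^+ 2) + r * cos alpha).
        by rewrite E mulr1.
      by ring.
    * transitivity (sin th * (cos alpha ^+ 2 + sin alpha ^+ 2) + r * sin alpha).
        by rewrite E mulr1.
      by ring.
  + by rewrite /p /q !per subrr mulr0.
Qed.

(** * The image and the variation of the circle *)

Lemma circle_image z : euclid_norm z = 1 -> (circle 0 @` `[0, 1]) z.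
Proof.
move=> z1; have [y /andP[y0 y2]] := polar_form z; rewrite z1 scale1r => zy.
have pi2 : 0 < 2 * pi :> R by rewrite mulr_gt0// pi_gt0.
exists (y / (2 * pi)).
  by rewrite /= in_itv/= divr_ge0//= ler_pdivrMr// mul1r.
by rewrite /circle addr0 mulrC divfK ?gt_eqF.
Qed.

(** Each coordinate is Lipschitz with constant [2 * pi], and the Euclidean norm is at most the sum
    of the absolute coordinates; the resulting bounds telescope to [4 * pi]. *)
Lemma finite_1_variation_circle c : finite_p_variation 1 0 1 (circle c).
Proof.
exists (4 * pi) => _ /= [s s01 <-]; rewrite /p_variation_sum.
have lip t u : t \in `[0, 1] -> u \in `[0, 1] -> t <= u ->
    euclid_norm (circle c u - circle c t) <= 4 * pi * u - 4 * pi * t.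
  move=> t01 u01 tu; apply: le_trans (euclid_norm_le _) _.
  have l0 := lipschitz_of_derive (K := 2 * pi) (a := 0) (b := 1)
    (fun x _ => is_derive_circle0 c x).
  have l1 := lipschitz_of_derive (K := 2 * pi) (a := 0) (b := 1)
    (fun x _ => is_derive_circle1 c x).
  have {l0} := l0 _ _ _ u01 t01; have {l1} := l1 _ _ _ u01 t01.
  rewrite !mxE (@ger0_norm _ (u - t)) ?subr_ge0// => H1 H0.
  have -> : 4 * pi * u - 4 * pi * t = 2 * pi * (u - t) + 2 * pi * (u - t) by ring.
  apply: lerD.
    by apply: H0 => x _; rewrite normrM normrN (ger0_norm pi2_ge0) ler_piMl// sin_max.
  by apply: H1 => x _; rewrite normrM (ger0_norm pi2_ge0) ler_piMl// cos_max.
apply: (@le_trans _ _ (\sum_(0 <= k < size s)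
    (4 * pi * nth 1 (0 :: s) k.+1 - 4 * pi * nth 1 (0 :: s) k))).
  rewrite !big_nat; apply: ler_sum => k /= ks.
  rewrite powRr1 ?euclid_norm_ge0//; apply: lip.
  - by rewrite in_itv/= itv_partition_nth_ge ?itv_partition_nth_le// ltnW.
  - by rewrite in_itv/= (@itv_partition_nth_ge _ _ 0 1 s k.+1)//
      (@itv_partition_nth_le _ _ 0 1 s k.+1).
  - exact: ltW (itv_partition_nth_lt s01 ks).
rewrite (itv_partition_telescope (fun x => 4 * pi * x) s01).
by rewrite mulr1 mulr0 subr0.
Qed.

End circle.

Theorem proposition21 (R : realType) :
  exists (p : R) (gamma gamma' : R -> 'rV[R]_2),
    1 <= p < 2 /\
    [/\ {within `[0, 1], continuous gamma}, gamma 0 = gamma 1 &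
        finite_p_variation p 0 1 gamma] /\
    [/\ {within `[0, 1], continuous gamma'}, gamma' 0 = gamma' 1 &
        finite_p_variation p 0 1 gamma'] /\
    (forall z : 'rV[R]_2,
       ~ (gamma @` `[0, 1]) z -> ~ (gamma' @` `[0, 1]) z ->
       exists w : R, is_winding_number gamma z w /\ is_winding_number gamma' z w) /\
    signature gamma 5 <> signature gamma' 5.
Proof.
have closed_curve c : [/\ {within `[0, 1], continuous (@circle R c)},
    circle c 0 = circle c 1 & finite_p_variation 1 0 1 (circle c)].
  split; [|by rewrite circle_period|exact: finite_1_variation_circle].
  by apply: continuous_subspaceT; exact: continuous_circle.
exists 1, (circle 0), (circle pi); split; first by rewrite lexx ltr1n.
split=> //; split=> //; split=> [z z0 _|].
  (* The polar form is taken of [- z], to match the centre in [is_winding_number_circle]; the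
     winding number found there does not depend on the phase. *)
  have [x _ zE] := polar_form (- z).
  have r1 : euclid_norm (- z) != 1.
    apply/eqP => z1; apply: z0; apply: circle_image.
    by rewrite -z1 /euclid_norm !mxE !sqrrN.
  have r0 := euclid_norm_ge0 (- z).
  rewrite -(opprK z) zE; eexists.
  by split; exact: is_winding_number_circle.
(* The word 11112 with letters counted from 0. The two coefficients are [- 7 * pi / 24] and
   [7 * pi / 24]. *)
move=> /ffunP /(_ [tuple 0; 0; 0; 0; 1]).
rewrite !ffunE (_ : rev _ = [:: 1; 0; 0; 0; 0])// !iterated_integral_circle.
rewrite cos0 cospi.
by have := pi_gt0 R; lra.
Qed.
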